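(* Consider an $[[n,k]]$ stabilizer code with stabilizer group $\mathcal S$, Clifford encoder $U_E$ and a set of syndrome representatives $T$, with encoding channel $\mathcal U$ and decoding channel $\mathcal D$, and let $\mathcal N=\mathcal T_p^{\otimes n}$ be the $n$-qubit depolarizing channel with rate $p$. Then \[ F_C(\mathcal D\mathcal N\mathcal U)=\sum_{E\in T\times\mathcal S}p_E=\sum_{w=0}^n a_w q_w, \] where $a_w$ is the number of elements of $T\times\mathcal S=\{hg:h\in T,\ g\in\mathcal S\}$ (Pauli operators up to phase) of weight $w$, $p_E$ is the probability of the Pauli error $E$ under $\mathcal N$, and $q_w=(1-\frac34p)^{n-w}(\frac14p)^w$. That is, the channel fidelity is the weight enumerator of $T\times\mathcal S$ evaluated on the probabilities $\{q_w\}$.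
   Context: Channel fidelity: for a channel $\mathcal E$ on an $m$-dimensional space with Kraus operators $\{K_i\}$, $F_C(\mathcal E)=\langle\psi|(I\otimes\mathcal E)(|\psi\rangle\langle\psi|)|\psi\rangle=\frac1{m^2}\sum_i|\mathrm{tr}K_i|^2$ with $|\psi\rangle=m^{-1/2}\sum_j|j\rangle|j\rangle$. Code setup: Pauli operators are tensor products of $I,X,Y,Z$ (up to phase); weight is the number of non-identity factors. $U_E$ is an $n$-qubit Clifford unitary, and $\mathcal S$ is generated by $g_j=U_EZ_{j+k}U_E^\dagger$, $j=1,\dots,n-k$. The syndrome of a Pauli $E$ is $s\in\{0,1\}^{n-k}$, $s_j=0$ iff $E$ commutes with $g_j$; $P_s=\prod_j\frac{I+(-1)^{s_j}g_j}{2}$. $T$ contains one Pauli $E_s$ of syndrome $s$ for each $s$, with $E_0=I$, and $C_s=E_s$. Encoding: $\mathcal U(\rho)=U_E(\rho\otimes|0\rangle\langle0|^{\otimes n-k})U_E^\dagger$ on $k$-qubit states $\rho$. Decoding: $\mathcal D(\rho')=\mathrm{tr}_{\mathrm{anc}}\big(\sum_sU_E^\dagger C_sP_s\rho'P_sC_s^\dagger U_E\big)$, the partial trace being over the last $n-k$ (ancilla) qubits. The depolarizing channel $\mathcal T_p(\rho)=(1-\frac34p)\rho+\frac p4(X\rho X+Y\rho Y+Z\rho Z)$ acts independently on each of the $n$ qubits, so a Pauli error of weight $w$ occurs with probability $q_w$. *)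

(* Defs.v *)
From HB Require Import structures.
From mathcomp Require Import all_boot all_order all_algebra.
From mathcomp Require Import complex.
From mathcomp Require Import boolp.
Unset Printing Implicit Defensive.
Import Order.TTheory GRing.Theory Num.Theory.
Local Open Scope ring_scope.
Local Open Scope complex_scope.

Section QCodes.
Variable R : rcfType.
Local Notation C := (R[i]).

Definition adj m n (A : 'M[C]_(m, n)) : 'M[C]_(n, m) := (map_mx Num.conj A)^T.

(* ---------- single-qubit Pauli matrices ----------
   A single-qubit Pauli letter is an element of 'I_4 : 0 = I, 1 = X, 2 = Y, 3 = Z. *)
Definition sigma (a : 'I_4) : 'M[C]_2 :=
  \matrix_(r < 2, c < 2)
    match val a with
    | 0 => if r == c then 1 else 0
    | 1 => if r == c then 0 else 1
    | 2 => if r == c then 0 else (if val r == 0 then - 'i else 'i)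
    | _ => if r == c then (if val r == 0 then 1 else -1) else 0
    end.

(* ---------- n-qubit conventions ----------
   Basis index i : 'I_(2^n); qubit q (0-indexed, q < n) is the bit of weight
   2^(n-1-q), so qubit 0 is the most significant one (big-endian, i.e. the
   usual ordering of the Kronecker product). *)
Definition bitq n (q : 'I_n) (i : nat) : 'I_2 := inord (odd (i %/ 2 ^ (n.-1 - q))).

(* the basis index with value i (i < 2^m in all uses; 0 otherwise) *)
Lemma pow2_gt0 m : (0 < 2 ^ m)%N. Proof. by rewrite expn_gt0. Qed.
Definition idx2 m (i : nat) : 'I_(2 ^ m) := insubd (Ordinal (pow2_gt0 m)) i.

Lemma anc_lt n k (j : 'I_(n - k)) : (j + k < n)%N.
Proof. have := ltn_ord j; rewrite ltn_subRL addnC; by []. Qed.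
Definition ancq n k (j : 'I_(n - k)) : 'I_n := Ordinal (anc_lt n k j).

(* Pauli operators (up to phase) on n qubits: strings of letters *)
Definition pstring n := {ffun 'I_n -> 'I_4}.

(* the matrix of the tensor product  P_0 (x) P_1 (x) ... (x) P_(n-1) *)
Definition pmat n (P : pstring n) : 'M[C]_(2 ^ n) :=
  \matrix_(i, j) \prod_(q < n) sigma (P q) (bitq n q i) (bitq n q j).

Definition weight n (P : pstring n) : nat := #|[set q | P q != 0]|.

Definition idstring n : pstring n := [ffun => 0].

Definition zstring n (q : 'I_n) : pstring n := [ffun r => if r == q then 3 else 0].

Definition unitary m (U : 'M[C]_m) : Prop := U *m adj _ _ U = 1%:M /\ adj _ _ U *m U = 1%:M.

Definition clifford n (U : 'M[C]_(2 ^ n)) : Prop :=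
  unitary _ U /\
  forall P : pstring n, exists (Q : pstring n) (c : C),
    U *m pmat n P *m adj _ _ U = c *: pmat n Q.

(* ---------- the stabilizer code ----------
   Generators g_j = U_E Z_{j+k} U_E^dagger, j = 1..n-k (1-indexed in the paper);
   here j : 'I_(n-k) is 0-indexed, so g_j acts by Z on (0-indexed) qubit j + k,
   i.e. on the ancilla qubits k, ..., n-1 (the last n-k qubits). *)
Definition gen n k (U : 'M[C]_(2 ^ n)) (j : 'I_(n - k)) : 'M[C]_(2 ^ n) :=
  U *m pmat n (zstring n (ancq n k j)) *m adj _ _ U.

Inductive inStab n k (U : 'M[C]_(2 ^ n)) : 'M[C]_(2 ^ n) -> Prop :=
  | Stab_gen j : inStab n k U (gen n k U j)
  | Stab_one : inStab n k U 1%:M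
  | Stab_mul A B : inStab n k U A -> inStab n k U B -> inStab n k U (A *m B)
  | Stab_inv A : inStab n k U A -> inStab n k U (invmx A).

Definition syndrome_t n k := {ffun 'I_(n - k) -> bool}.

Definition syndrome n k (U : 'M[C]_(2 ^ n)) (E : pstring n) : syndrome_t n k :=
  [ffun j => ~~ (pmat n E *m gen n k U j == gen n k U j *m pmat n E)].

Definition zero_syndrome n k : syndrome_t n k := [ffun => false].

Definition synproj n k (U : 'M[C]_(2 ^ n)) (s : syndrome_t n k) : 'M[C]_(2 ^ n) :=
  \big[mulmx/1%:M]_(j < n - k)
     (2^-1 *: (1%:M + (if s j then -1 else 1) *: gen n k U j)).

(* ---------- encoding and decoding channels ----------
   (rho (x) |0><0|^{(x) n-k}) : data = first k qubits (high bits),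
   ancillas = last n-k qubits (low bits). *)
Definition attach_anc n k (rho : 'M[C]_(2 ^ k)) : 'M[C]_(2 ^ n) :=
  \matrix_(i, j)
    if (i %% 2 ^ (n - k) == 0)%N && (j %% 2 ^ (n - k) == 0)%N
    then rho (idx2 k (i %/ 2 ^ (n - k))) (idx2 k (j %/ 2 ^ (n - k)))
    else 0.

Definition ptrace_anc n k (X : 'M[C]_(2 ^ n)) : 'M[C]_(2 ^ k) :=
  \matrix_(a, b) \sum_(c < 2 ^ (n - k))
      X (idx2 n (a * 2 ^ (n - k) + c)) (idx2 n (b * 2 ^ (n - k) + c)).

Definition encode n k (U : 'M[C]_(2 ^ n)) (rho : 'M[C]_(2 ^ k)) : 'M[C]_(2 ^ n) :=
  U *m attach_anc n k rho *m adj _ _ U.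

Definition decode n k (U : 'M[C]_(2 ^ n)) (T : syndrome_t n k -> pstring n)
  (rho' : 'M[C]_(2 ^ n)) : 'M[C]_(2 ^ k) :=
  ptrace_anc n k (\sum_(s : syndrome_t n k)
     adj _ _ U *m pmat n (T s) *m synproj n k U s *m rho' *m synproj n k U s
           *m adj _ _ (pmat n (T s)) *m U).

Definition depol1 (p : R) (rho : 'M[C]_2) : 'M[C]_2 :=
  (1 - 3 / 4 * p)%:C *: rho +
  (p / 4)%:C *: (sigma 1 *m rho *m sigma 1 + sigma 2 *m rho *m sigma 2
                 + sigma 3 *m rho *m sigma 3).

(* n-fold tensor power of a single-qubit linear map T, defined on the
   matrix-unit basis |a><b| = (x)_q |a_q><b_q| and extended linearly *)
Definition tenspow n (T : 'M[C]_2 -> 'M[C]_2) (rho : 'M[C]_(2 ^ n)) : 'M[C]_(2 ^ n) :=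
  \matrix_(i, j) \sum_(a < 2 ^ n) \sum_(b < 2 ^ n)
     rho a b * \prod_(q < n) T (delta_mx (bitq n q a) (bitq n q b)) (bitq n q i) (bitq n q j).

Definition depol n (p : R) := tenspow n (depol1 p).

(* ---------- channel fidelity ----------
   F_C(E) = <psi| (I (x) E)(|psi><psi|) |psi>,  psi = m^{-1/2} sum_j |j>|j>.
   Bipartite operators are functions on ('I_m * 'I_m)^2, first component = the
   reference system. *)
Definition mes m (u : 'I_m * 'I_m) : C := (u.1 == u.2)%:R / sqrtC m%:R.

Definition id_tens m (E : 'M[C]_m -> 'M[C]_m)
  (X : 'I_m * 'I_m -> 'I_m * 'I_m -> C) (u v : 'I_m * 'I_m) : C :=
  \sum_(x < m) \sum_(y < m) X (u.1, x) (v.1, y) * E (delta_mx x y) u.2 v.2.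

Definition chan_fid m (E : 'M[C]_m -> 'M[C]_m) : C :=
  \sum_(u : 'I_m * 'I_m) \sum_(v : 'I_m * 'I_m)
     Num.conj (mes m u) * id_tens m E (fun u' v' => mes m u' * Num.conj (mes m v')) u v * mes m v.

Definition inTS n k (U : 'M[C]_(2 ^ n)) (T : syndrome_t n k -> pstring n)
  (P : pstring n) : Prop :=
  exists (s : syndrome_t n k) (g : 'M[C]_(2 ^ n)) (c : C),
    inStab n k U g /\ pmat n P = c *: (pmat n (T s) *m g).

Definition perr n (p : R) (P : pstring n) : R :=
  \prod_(q < n) (if P q == 0 then 1 - 3 / 4 * p else p / 4).

Definition qw n (p : R) (w : nat) : R := (1 - 3 / 4 * p) ^+ (n - w) * (p / 4) ^+ w.

Definition aw n k (U : 'M[C]_(2 ^ n)) (T : syndrome_t n k -> pstring n) (w : nat) : nat :=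
  #|[set P : pstring n | `[< inTS n k U T P >] && (weight n P == w)]|.

End QCodes.

Arguments sigma {R}. Arguments pmat {R} n. Arguments gen {R} n k. Arguments inStab {R} n k.
Arguments syndrome {R} n k. Arguments synproj {R} n k. Arguments encode {R} n k.
Arguments decode {R} n k. Arguments depol {R} n. Arguments chan_fid {R} m.
Arguments inTS {R} n k. Arguments aw {R} n k. Arguments clifford {R} n.
Arguments perr {R} n. Arguments qw {R} n. Arguments unitary {R} m. Arguments adj {R} m n.

(* Main.v *)
(** In the Pauli basis the depolarizing channel has Kraus operators [P] with weights
    [perr P], so the whole channel has Kraus operators
    [<c| U^H C_s P_s P U |0>], with [c] running over ancilla states. Conjugated by
    [U], the generators become the ancilla [Z]s, hence [U^H P U] shifts the ancilla
    bits by the syndrome of [P]; only [s = syndrome P] and [c = 0] survive, and the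
    fidelity is [4^-k * \sum_P perr P * |tr (C_s P P_0)|^2].
    The code projector [P_0] is the average of the stabilizer group. If [C_s P] is a
    phase times a stabilizer element, it fixes [P_0] up to that phase and the trace has
    modulus [tr P_0 = 2^k]; otherwise [C_s P] is trace-orthogonal to every stabilizer
    element and the trace vanishes. *)
Require Import Defs.
From HB Require Import structures.
From mathcomp Require Import all_boot all_order all_algebra.
From mathcomp Require Import complex boolp.
From mathcomp Require Import ring zify.
Import Order.TTheory GRing.Theory Num.Theory.
Local Open Scope ring_scope.
Local Open Scope complex_scope.

(** * Binary digits and single-qubit Pauli matrices *)

Section BinaryDigits.
Local Open Scope nat_scope.

Lemma binary_digits_inj m x y : x < 2 ^ m -> y < 2 ^ m ->
  (forall l, l < m -> odd (x %/ 2 ^ l) = odd (y %/ 2 ^ l)) -> x = y.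
Proof.
elim: m x y => [|m IH] x y; first by rewrite expn0; case: x; case: y.
move=> xm ym eq_odd; rewrite -(odd_double_half x) -(odd_double_half y).
have := eq_odd 0 isT; rewrite !divn1 => ->; congr (_ + _.*2).
apply: IH; rewrite -?divn2 ?ltn_divLR // -?expnSr //.
by move=> l lm; rewrite -!divnMA -expnS; apply: eq_odd.
Qed.

(** The ancillas are the low-order bits of a basis index, so this turns the remainder test in
    [attach_anc] into a condition on each ancilla bit. *)
Lemma modn_pow2_eq0P m x :
  reflect (forall l, l < m -> ~~ odd (x %/ 2 ^ l)) (x %% 2 ^ m == 0).
Proof.
have bitm l : l < m -> odd ((x %% 2 ^ m) %/ 2 ^ l) = odd (x %/ 2 ^ l).
  move=> lm; rewrite divn_modl ?dvdn_exp2l ?(ltnW lm) // -expnB ?(ltnW lm) //.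
  by rewrite odd_mod // oddX subn_eq0 leqNgt lm.
apply: (iffP eqP) => [x0 l lm|x0]; first by rewrite -bitm // x0 div0n.
apply: (@binary_digits_inj m) => [||l lm]; rewrite ?ltn_mod ?expn_gt0 //.
by rewrite bitm // div0n; apply: negbTE (x0 l lm).
Qed.

Lemma ord_bits_inj n (i j : 'I_(2 ^ n)) : (forall q, bitq n q i = bitq n q j) -> i = j.
Proof.
move=> eqb; apply/val_inj/(@binary_digits_inj n) => [||l ln]; rewrite ?ltn_ord //.
(* The bit of weight [2 ^ l] belongs to qubit [n.-1 - l], the order being big-endian. *)
have lt : n.-1 - l < n by rewrite (leq_ltn_trans (leq_subr _ _)) // prednK // (leq_ltn_trans _ ln).
have := congr1 (@nat_of_ord 2) (eqb (Ordinal lt)).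
rewrite /bitq /= subKn; last by rewrite -ltnS prednK // (leq_ltn_trans _ ln).
by rewrite !inordK; do 2?case: odd.
Qed.

End BinaryDigits.

(** * Pauli letters and the one-qubit depolarizing channel *)

Section SingleQubit.
Variable R : rcfType.
Local Notation C := R[i].
Implicit Types a b : 'I_4.

Lemma sumr_I2 (V : nmodType) (F : 'I_2 -> V) : \sum_i F i = F 0 + F 1.
Proof.
by rewrite big_ord_recl big_ord1; congr (_ + F _); apply: val_inj.
Qed.

Lemma ord2P (P : 'I_2 -> Prop) : P 0 -> P 1 -> forall x, P x.
Proof.
move=> P0 P1 [[|[|//]] lt]; first by rewrite (_ : Ordinal lt = 0) //; apply: val_inj.
by rewrite (_ : Ordinal lt = 1) //; apply: val_inj.
Qed.

Lemma ord4P (P : 'I_4 -> Prop) : P 0 -> P 1 -> P 2 -> P 3 -> forall a, P a.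
Proof.
move=> P0 P1 P2 P3 [[|[|[|[|//]]]] lt].
- by rewrite (_ : Ordinal lt = 0) //; apply: val_inj.
- by rewrite (_ : Ordinal lt = 1) //; apply: val_inj.
- by rewrite (_ : Ordinal lt = 2) //; apply: val_inj.
- by rewrite (_ : Ordinal lt = 3) //; apply: val_inj.
Qed.

Let sqri : 'i%R * 'i%R = -1 :> C. Proof. by rewrite -expr2 sqrCi. Qed.

Lemma sigma_conj a i j : Num.conj (sigma a i j) = sigma a j i :> C.
Proof.
move: a i j; apply: ord4P; apply: ord2P; apply: ord2P; rewrite !mxE /=;
  by rewrite ?(rmorphN1, rmorph1, rmorph0, rmorphN) /= ?conjCi ?opprK.
Qed.

Ltac sigma_entries :=
  apply/matrixP; do 2![apply: ord2P];
  rewrite !mxE ?sumr_I2 ?mxE /=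
    ?(mulr0, mul0r, mulr1, mul1r, addr0, add0r, mulrN, mulNr, opprK, oppr0, sqri);
  reflexivity.

(** Scalar and letter are packed into one pair so that [fin_all_exists] can choose both for all
    qubits at once. *)
Lemma sigma_mul a b :
  exists ce : C * 'I_4, sigma a *m sigma b = ce.1 *: sigma ce.2.
Proof.
have prod_is (c : C) e : sigma a *m sigma b = c *: sigma e ->
  exists ce : C * 'I_4, sigma a *m sigma b = ce.1 *: sigma ce.2 by exists (c, e).
move: a b prod_is; apply: ord4P; apply: ord4P => prod_is.
- by apply: (prod_is 1 0); sigma_entries.
- by apply: (prod_is 1 1); sigma_entries.
- by apply: (prod_is 1 2); sigma_entries.
- by apply: (prod_is 1 3); sigma_entries.
- by apply: (prod_is 1 1); sigma_entries.
- by apply: (prod_is 1 0); sigma_entries.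
- by apply: (prod_is 'i%R 3); sigma_entries.
- by apply: (prod_is (- 'i%R) 2); sigma_entries.
- by apply: (prod_is 1 2); sigma_entries.
- by apply: (prod_is (- 'i%R) 3); sigma_entries.
- by apply: (prod_is 1 0); sigma_entries.
- by apply: (prod_is 'i%R 1); sigma_entries.
- by apply: (prod_is 1 3); sigma_entries.
- by apply: (prod_is 'i%R 2); sigma_entries.
- by apply: (prod_is (- 'i%R) 1); sigma_entries.
- by apply: (prod_is 1 0); sigma_entries.
Qed.

Lemma sigma_comm a b :
  exists e : bool, sigma a *m sigma b = (-1) ^+ e *: (sigma b *m sigma a) :> 'M[C]_2.
Proof.
(* Two letters anticommute exactly when they are distinct and neither is the identity. *)
exists [&& a != 0, b != 0 & a != b].
move: a b; apply: ord4P; apply: ord4P; sigma_entries.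
Qed.

Lemma sigma_sqr a : sigma a *m sigma a = 1%:M :> 'M[C]_2.
Proof. move: a; apply: ord4P; sigma_entries. Qed.

Lemma sigma0 : sigma 0 = 1%:M :> 'M[C]_2.
Proof. sigma_entries. Qed.

Lemma sigma_tr0 a b : a != b -> \tr (sigma a *m sigma b) = 0 :> C.
Proof.
move: a b; apply: ord4P; apply: ord4P => // _; rewrite /mxtrace sumr_I2 !mxE !sumr_I2 !mxE /=.
all: rewrite ?(mulr0, mul0r, mulr1, mul1r, addr0, add0r, mulrN, mulNr, opprK,
  oppr0, sqri) ?subrr ?addNr //.
Qed.

Definition depol1_weight (p : R) a : R := if a == 0 then 1 - 3 / 4 * p else p / 4.

Lemma depol1_kraus p (rho : 'M[C]_2) :
  depol1 R p rho = \sum_a (depol1_weight p a)%:C *: (sigma a *m rho *m sigma a).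
Proof.
rewrite !big_ord_recl big_ord0 addr0 /depol1 /depol1_weight /= sigma0 mul1mx mulmx1.
rewrite !scalerDr !addrA.
by congr (_ + _ *: (sigma _ *m _ *m sigma _) + _ *: (sigma _ *m _ *m sigma _)
  + _ *: (sigma _ *m _ *m sigma _)); apply: val_inj.
Qed.
End SingleQubit.

(** * Pauli strings and the depolarizing channel *)

(** As $|a\rangle\langle b|$ has rank one, the product is column [a] of [A] times row [b] of [B].
    Kraus terms applied to matrix units thus become products of two entries. *)
Lemma mulmx_deltaE (S : pzSemiRingType) m n l r (A : 'M[S]_(m, n)) (B : 'M[S]_(l, r)) a b i j :
  (A *m delta_mx a b *m B) i j = A i a * B b j.
Proof.
rewrite mxE (bigD1 b) //= [X in _ + X]big1 ?addr0.
  congr (_ * _); rewrite mxE (bigD1 a) //= big1 ?addr0 ?mxE ?eqxx ?mulr1 // => x /negbTE xa.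
  by rewrite mxE xa mulr0.
move=> y /negbTE yb; rewrite mxE big1 ?mul0r // => x _.
by rewrite mxE yb andbF mulr0.
Qed.

Section Adjoint.
Variable R : rcfType.
Local Notation C := R[i].
Local Notation "A ^H" := (adj _ _ A) (at level 1, format "A ^H").

Lemma adjE m n (A : 'M[C]_(m, n)) i j : A^H i j = Num.conj (A j i).
Proof. by rewrite !mxE. Qed.

Lemma adj_mul m n l (A : 'M[C]_(m, n)) (B : 'M[C]_(n, l)) :
  (A *m B)^H = B^H *m A^H.
Proof. by rewrite /adj map_mxM trmx_mul. Qed.

Lemma adjK m n (A : 'M[C]_(m, n)) : A^H^H = A.
Proof. by apply/matrixP=> i j; rewrite !adjE conjCK. Qed.

Lemma adj_scale m n c (A : 'M[C]_(m, n)) : (c *: A)^H = Num.conj c *: A^H.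
Proof. by apply/matrixP=> i j; rewrite !mxE rmorphM. Qed.

End Adjoint.

Section Pauli.
Variables (R : rcfType) (n : nat).
Local Notation C := R[i].
Local Notation "A ^H" := (adj _ _ A) (at level 1, format "A ^H").
Implicit Types P Q : pstring n.

(** Indices below $2^n$ correspond to bit strings, so a sum over basis states of a product over
    qubits factors. Products and traces of Pauli strings are computed letter by letter through this
    identity. *)
Lemma sum_prod_bits (F : 'I_n -> 'I_2 -> C) :
  \sum_(i < 2 ^ n) \prod_q F q (bitq n q i) = \prod_q \sum_b F q b.
Proof.
rewrite bigA_distr_bigA /=.
pose f (i : 'I_(2 ^ n)) := [ffun q => bitq n q i].
have f_inj : injective f.
  by move=> i j /ffunP eqf; apply: ord_bits_inj => q; have := eqf q; rewrite !ffunE.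
rewrite (reindex f) /=; last first.
  by apply/onW_bij/inj_card_bij => //; rewrite card_ffun !card_ord.
by apply: eq_bigr => i _; apply: eq_bigr => q _; rewrite ffunE.
Qed.

Lemma pmatE P i j :
  pmat n P i j = \prod_q sigma (P q) (bitq n q i) (bitq n q j) :> C.
Proof. by rewrite mxE. Qed.

Lemma pmat_mulE P Q i j :
  (pmat n P *m pmat n Q) i j
  = \prod_q (sigma (P q) *m sigma (Q q)) (bitq n q i) (bitq n q j) :> C.
Proof.
rewrite mxE; under [LHS]eq_bigr do rewrite !pmatE -big_split /=.
rewrite (sum_prod_bits (fun q b =>
  sigma (P q) (bitq n q i) b * sigma (Q q) b (bitq n q j))).
by apply: eq_bigr => q _; rewrite [RHS]mxE.
Qed.

Lemma prod_delta_bits (i j : 'I_(2 ^ n)) :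
  \prod_(q < n) (1%:M : 'M[C]_2) (bitq n q i) (bitq n q j) = (i == j)%:R.
Proof.
have [->|neq_ij] := eqVneq; first by apply: big1 => q _; rewrite mxE eqxx.
have [q neq_q|eqb] := pickP (fun q => bitq n q i != bitq n q j).
  by rewrite (bigD1 q) //= mxE (negbTE neq_q) mul0r.
by case/eqP: neq_ij; apply: ord_bits_inj => q; apply/eqP/negbFE/eqb.
Qed.

Lemma pmat_sqr P : pmat n P *m pmat n P = 1%:M :> 'M[C]_(2 ^ n).
Proof.
apply/matrixP=> i j; rewrite pmat_mulE [RHS]mxE -prod_delta_bits.
by apply: eq_bigr => q _; rewrite sigma_sqr.
Qed.

Lemma pmat_adj P : (pmat n P)^H = pmat n P :> 'M[C]_(2 ^ n).
Proof.
apply/matrixP=> i j; rewrite adjE !pmatE rmorph_prod.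
by apply: eq_bigr => q _; exact: sigma_conj.
Qed.

Lemma pmat_idstring : pmat n (idstring n) = 1%:M :> 'M[C]_(2 ^ n).
Proof.
apply/matrixP=> i j; rewrite pmatE mxE -prod_delta_bits.
by apply: eq_bigr => q _; rewrite ffunE sigma0.
Qed.

Lemma pmat_mul P Q :
  exists (c : C) (S : pstring n), pmat n P *m pmat n Q = c *: pmat n S.
Proof.
have [ce ceE] := fin_all_exists (fun q => sigma_mul R (P q) (Q q)).
exists (\prod_q (ce q).1), [ffun q => (ce q).2].
apply/matrixP=> i j; rewrite pmat_mulE mxE pmatE -big_split /=.
by apply: eq_bigr => q _; rewrite ceE ffunE mxE.
Qed.

Lemma pmat_comm P Q :
  exists e : bool,
    pmat n P *m pmat n Q = (-1) ^+ e *: (pmat n Q *m pmat n P) :> 'M[C]_(2 ^ n).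
Proof.
have [e eE] := fin_all_exists (fun q => sigma_comm R (P q) (Q q)).
(* Only the parity of the number of anticommuting positions survives. *)
exists (odd (\sum_q e q)).
apply/matrixP=> i j; rewrite [RHS]mxE !pmat_mulE signr_odd expr_sum -big_split /=.
by apply: eq_bigr => q _; rewrite eE [LHS]mxE.
Qed.

Lemma pmat_tr0 P Q : P != Q -> \tr (pmat n P *m pmat n Q) = 0 :> C.
Proof.
move=> neq_PQ; rewrite /mxtrace (eq_bigr _ (fun i _ => pmat_mulE P Q i i)).
rewrite (sum_prod_bits (fun q b => (sigma (P q) *m sigma (Q q)) b b)).
have [q neq_q|eqPQ] := pickP (fun q => P q != Q q).
  by rewrite (bigD1 q) //= [X in X * _](sigma_tr0 R _ _ neq_q) mul0r.
by case/eqP: neq_PQ; apply/ffunP => q; apply/eqP/negbFE/eqPQ.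
Qed.

Lemma perr_letters p P : perr n p P = \prod_q depol1_weight R p (P q).
Proof. by []. Qed.

(** Expanding the product over qubits of one-qubit Kraus sums gives one term per choice of a letter
    at each qubit, that is, per Pauli string. *)
Lemma depol_kraus p (rho : 'M[C]_(2 ^ n)) :
  depol n p rho = \sum_P (perr n p P)%:C *: (pmat n P *m rho *m pmat n P).
Proof.
apply/matrixP=> i j; rewrite mxE summxE.
transitivity (\sum_a \sum_b \sum_P
  rho a b * ((perr n p P)%:C * (pmat n P i a * pmat n P b j))).
  apply: eq_bigr => a _; apply: eq_bigr => b _; rewrite -mulr_sumr; congr (_ * _).
  under eq_bigr => q _ do
    rewrite depol1_kraus summxE.
  rewrite bigA_distr_bigA /=; apply: eq_bigr => P _.
  rewrite perr_letters rmorph_prod /= !pmatE -!big_split /=; apply: eq_bigr => q _.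
  by rewrite [LHS]mxE mulmx_deltaE.
under eq_bigr do rewrite exchange_big /=.
rewrite exchange_big /=; apply: eq_bigr => P _; rewrite mxE [in RHS]mxE mulr_sumr.
rewrite exchange_big /=; apply: eq_bigr => b _.
rewrite [(pmat n P *m rho) i b]mxE mulr_suml mulr_sumr.
by apply: eq_bigr => a _; ring.
Qed.

End Pauli.

(** * Ancilla bits and channel fidelity *)

Section AncillaBits.
Variables n k : nat.
Hypothesis le_kn : (k <= n)%N.

(** Typed as a syndrome, so that ancilla bits can be compared directly with measured syndromes. *)
Definition anc_bits (i : 'I_(2 ^ n)) : syndrome_t n k :=
  [ffun j => odd (i %/ 2 ^ (n.-1 - ancq n k j))].

(** The index of $|a\rangle|c\rangle$, with the data in the high bits. *)
Definition joint_idx (a c : nat) : 'I_(2 ^ n) := idx2 n (a * 2 ^ (n - k) + c).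

Let pow2_split : (2 ^ n = 2 ^ k * 2 ^ (n - k))%N.
Proof. by rewrite -expnD subnKC. Qed.

Lemma joint_idxE (a : 'I_(2 ^ k)) (c : 'I_(2 ^ (n - k))) :
  joint_idx a c = (a * 2 ^ (n - k) + c)%N :> nat.
Proof.
rewrite /joint_idx /idx2 val_insubd ifT // pow2_split.
by apply: leq_trans (_ : (a.+1 * 2 ^ (n - k) <= _)%N);
  rewrite ?leq_mul2r ?ltn_ord ?orbT // mulSn addnC ltn_add2r.
Qed.

Lemma anc_bits_eq0 (i : 'I_(2 ^ n)) :
  (anc_bits i == zero_syndrome n k) = (i %% 2 ^ (n - k) == 0)%N.
Proof.
apply/eqP/modn_pow2_eq0P => [anc0 l l_lt|bits0].
  (* Bit [l] of the remainder is ancilla [n - k - l.+1], again by the big-endian order. *)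
  have lt : (n - k - l.+1 < n - k)%N by lia.
  have /ffunP/(_ (Ordinal lt)) := anc0; rewrite !ffunE /=.
  by rewrite (_ : n.-1 - _ = l)%N; [move=> ->|lia].
apply/ffunP=> j; rewrite !ffunE /=; apply/negbTE/bits0.
by have := ltn_ord j; lia.
Qed.

Lemma anc_bits_joint (a : 'I_(2 ^ k)) (c : 'I_(2 ^ (n - k))) :
  (anc_bits (joint_idx a c) == zero_syndrome n k) = (c == 0 :> nat).
Proof. by rewrite anc_bits_eq0 joint_idxE modnMDl modn_small. Qed.

Lemma joint_idx0E (a : 'I_(2 ^ k)) : joint_idx a 0 = (a * 2 ^ (n - k))%N :> nat.
Proof. by have := joint_idxE a (Ordinal (pow2_gt0 (n - k))); rewrite /= addn0. Qed.

Lemma eq_joint_idx0 (i : 'I_(2 ^ n)) (a : 'I_(2 ^ k)) :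
  (i == joint_idx a 0)
  = (i %% 2 ^ (n - k) == 0)%N && (idx2 k (i %/ 2 ^ (n - k)) == a).
Proof.
have lt_div : (i %/ 2 ^ (n - k) < 2 ^ k)%N.
  by rewrite ltn_divLR ?expn_gt0 // -pow2_split.
rewrite -val_eqE /= joint_idx0E -[X in _ && X]val_eqE /idx2 /= val_insubd lt_div.
apply/eqP/andP=> [->|[/eqP r0 /eqP <-]]; first by rewrite modnMl mulnK ?expn_gt0 ?eqxx.
by rewrite {1}(divn_eq i (2 ^ (n - k))) r0 addn0.
Qed.

Lemma sum_anc0 (V : nmodType) (F : 'I_(2 ^ n) -> V) :
  \sum_(i | anc_bits i == zero_syndrome n k) F i = \sum_(a < 2 ^ k) F (joint_idx a 0).
Proof.
rewrite (reindex_onto (fun a : 'I_(2 ^ k) => joint_idx a 0)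
  (fun i => idx2 k (i %/ 2 ^ (n - k)))) /=.
  apply: eq_bigl => a; rewrite anc_bits_eq0.
  by rewrite -(eq_joint_idx0 (joint_idx a 0) a) eqxx.
move=> i; rewrite anc_bits_eq0 => i0; apply/esym/eqP.
by rewrite eq_joint_idx0 i0 eqxx.
Qed.

Lemma attach_anc_delta (R : rcfType) (a b : 'I_(2 ^ k)) :
  attach_anc R n k (delta_mx a b) = delta_mx (joint_idx a 0) (joint_idx b 0).
Proof.
apply/matrixP=> i j; rewrite !mxE !eq_joint_idx0.
by do 2![case: (_ %% _ == 0)%N => /=]; rewrite ?andbF.
Qed.

Lemma zero_syndromeP (s : syndrome_t n k) :
  reflect (forall j, s j = false) (s == zero_syndrome n k).
Proof.
by apply: (iffP eqP) => [-> j|s0]; [rewrite ffunE|apply/ffunP=> j; rewrite ffunE s0].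
Qed.

End AncillaBits.

(** * Channel fidelity in terms of matrix units *)

Section Fidelity.
Variables (R : rcfType) (m : nat).

Lemma sum_diag (V : nmodType) (F : 'I_m * 'I_m -> V) :
  \sum_(u | u.1 == u.2) F u = \sum_a F (a, a).
Proof.
rewrite (reindex_onto (fun a => (a, a)) (fun u => u.1)) /=; last first.
  by case=> a b /eqP /= ->.
by apply: eq_bigl => a; rewrite !eqxx.
Qed.

(** The state $\psi$ is supported on equal pairs with amplitude $m^{-1/2}$, and four amplitudes
    occur in each term, whence the factor $m^{-2}$. *)
Lemma chan_fidE (E : 'M[R[i]]_m -> 'M[R[i]]_m) :
  chan_fid m E = m%:R^-1 ^+ 2 * \sum_a \sum_b E (delta_mx a b) a b.
Proof.
set r : R[i] := (sqrtC m%:R)^-1.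
have r2 : r * r = m%:R^-1 by rewrite -expr2 exprVn sqrtCK.
have r_conj : Num.conj r = r.
  by apply: geC0_conj; rewrite invr_ge0 sqrtC_ge0 ler0n.
have mesE u : mes R m u = if u.1 == u.2 then r else 0.
  by rewrite /mes; case: eqP; rewrite ?mul1r ?mul0r.
have mes_conj u : Num.conj (mes R m u) = mes R m u.
  by rewrite mesE; case: eqP => _; rewrite ?rmorph0.
(* The reference system is untouched, so its indices force [x = u.1] and [y = v.1]. *)
have idE u v :
    id_tens R m E (fun u' v' => mes R m u' * Num.conj (mes R m v')) u v
    = r * r * E (delta_mx u.1 v.1) u.2 v.2.
  rewrite /id_tens (bigD1 u.1) //= [X in _ + X]big1 ?addr0; last first.
    move=> x /negbTE ux; rewrite big1 // => y _.
    by rewrite mesE /= eq_sym ux !mul0r.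
  rewrite (bigD1 v.1) //= [X in _ + X]big1 ?addr0; last first.
    move=> y /negbTE vy.
    by rewrite mes_conj !mesE /= [v.1 == _]eq_sym vy mulr0 mul0r.
  by rewrite mes_conj !mesE /= !eqxx.
rewrite /chan_fid mulr_sumr -(sum_diag _ (fun u => _ * \sum_b E (delta_mx u.1 b) u.2 b)).
rewrite [RHS]big_mkcond /=; apply: eq_bigr => u _.
under eq_bigr do rewrite idE mes_conj.
case: ifP => u12; last by rewrite big1 // => v _; rewrite mesE u12 !mul0r.
rewrite mulr_sumr -(sum_diag _ (fun v => _ * E (delta_mx u.1 v.1) u.2 v.2)).
rewrite [RHS]big_mkcond /=; apply: eq_bigr => v _.
rewrite !mesE u12; case: ifP => _; last by rewrite mulr0.
by rewrite -r2; ring.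
Qed.

End Fidelity.

(** * The stabilizer code *)

Lemma invmx_involution (S : comUnitRingType) m (A : 'M[S]_m) :
  A *m A = 1%:M -> invmx A = A.
Proof.
move=> AA; have [unitA _] := mulmx1_unit AA.
by rewrite -[RHS]mul1mx -(mulVmx unitA) -mulmxA AA mulmx1.
Qed.

Section Code.
Variables (R : rcfType) (n k : nat) (U : 'M[R[i]]_(2 ^ n)).
Hypothesis unitU : unitary _ U.
Local Notation C := R[i].
Local Notation "A ^H" := (adj _ _ A) (at level 1, format "A ^H").
Local Notation anc := (anc_bits n k).
Local Notation g := (gen n k U).
Implicit Types (s : syndrome_t n k) (P : pstring n) (W : 'M[C]_(2 ^ n)).

Let mulUUH : U *m U^H = 1%:M := proj1 unitU.
Let mulUHU : U^H *m U = 1%:M := proj2 unitU.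

(** Operators diagonal in the encoded basis $U|i\rangle$. Generators, syndrome projectors and
    stabilizer elements all have this form, which reduces their algebra to entrywise arithmetic on
    rows. *)
Definition conj_diag (d : 'rV[C]_(2 ^ n)) : 'M[C]_(2 ^ n) := U *m diag_mx d *m U^H.

Lemma conj_diagM d e : conj_diag d *m conj_diag e = conj_diag (\row_i (d 0 i * e 0 i)).
Proof.
by rewrite /conj_diag -mulmx_diag !mulmxA -[_ *m U^H *m U]mulmxA mulUHU mulmx1.
Qed.

Lemma conj_diag_comm d e : conj_diag d *m conj_diag e = conj_diag e *m conj_diag d.
Proof. by rewrite !conj_diagM; congr conj_diag; apply/rowP=> i; rewrite !mxE mulrC. Qed.

Lemma conj_diag1 : conj_diag (const_mx 1) = 1%:M.
Proof. by rewrite /conj_diag diag_const_mx mulmx1. Qed.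

Lemma conj_diag0 : conj_diag 0 = 0.
Proof. by rewrite /conj_diag linear0 mulmx0 mul0mx. Qed.

Lemma conj_diagD a d e : conj_diag (a *: d + e) = a *: conj_diag d + conj_diag e.
Proof. by rewrite /conj_diag linearP mulmxDr mulmxDl -scalemxAr -scalemxAl. Qed.

Lemma diag_adj m (d : 'rV[C]_m) :
  (forall i, Num.conj (d 0 i) = d 0 i) -> (diag_mx d)^H = diag_mx d.
Proof.
move=> d_real; apply/matrixP=> i j; rewrite !mxE eq_sym.
by case: eqP => [->|_]; rewrite ?mulr1n ?mulr0n ?d_real ?rmorph0.
Qed.

Lemma conj_diag_adj (d : 'rV[C]_(2 ^ n)) :
  (forall i, Num.conj (d 0 i) = d 0 i) -> (conj_diag d)^H = conj_diag d.
Proof. by move=> d_real; rewrite /conj_diag !adj_mul adjK diag_adj // mulmxA. Qed.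

Lemma pmat_zstring (q : 'I_n) :
  pmat n (zstring n q) = diag_mx (\row_i (-1) ^+ odd (i %/ 2 ^ (n.-1 - q))) :> 'M[C]_(2 ^ n).
Proof.
apply/matrixP=> i j; rewrite pmatE !mxE.
have [->|neq_ij] := eqVneq i j.
  rewrite mulr1n (bigD1 q) //= big1 ?mulr1 => [|r /negbTE rq].
    by rewrite ffunE eqxx mxE eqxx /= /bitq inordK; case: odd.
  by rewrite ffunE rq sigma0 mxE eqxx.
have [q' neq_q|eqb] := pickP (fun q => bitq n q i != bitq n q j).
  rewrite (bigD1 q') //= ffunE.
  by case: ifP => _; rewrite mxE (negbTE neq_q) mul0r.
by case/eqP: neq_ij; apply: ord_bits_inj => r; apply/eqP/negbFE/eqb.
Qed.

Lemma genE j : g j = conj_diag (\row_i (-1) ^+ anc i j).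
Proof.
rewrite /gen pmat_zstring /conj_diag; congr (_ *m diag_mx _ *m _).
by apply/rowP=> i; rewrite !mxE ffunE.
Qed.

Lemma gen_sqr j : g j *m g j = 1%:M.
Proof.
rewrite genE conj_diagM -conj_diag1; congr conj_diag.
by apply/rowP=> i; rewrite !mxE -expr2 sqrr_sign.
Qed.

(** In the encoded basis [g j] has eigenvalue $(-1)^{\mathrm{anc}_j}$, so each factor is the
    indicator of [anc i j == s j], and the product tests all ancilla bits. *)
Lemma synprojE s : synproj n k U s = conj_diag (\row_i (anc i == s)%:R).
Proof.
have -> : synproj n k U s = conj_diag (\row_i \prod_j (anc i j == s j)%:R).
  rewrite /synproj; elim: (index_enum _) => [|j l IH].
    rewrite big_nil -conj_diag1; congr conj_diag.
    by apply/rowP=> i; rewrite !mxE big_nil.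
  rewrite big_cons IH {IH} (_ : _ *: _ = conj_diag (\row_i (anc i j == s j)%:R)).
    rewrite conj_diagM; congr conj_diag.
    by apply/rowP=> i; rewrite !mxE big_cons.
  (* Adding [conj_diag 0] gives the outer scaling the shape [a *: d + e] required by
     [conj_diagD]. *)
  rewrite genE -conj_diag1 [_ + _]addrC -conj_diagD -[LHS]addr0 -conj_diag0 -conj_diagD.
  congr conj_diag; apply/rowP=> i; rewrite !mxE.
  have two0 : 2 != 0 :> C by rewrite pnatr_eq0.
  by case: (anc i j); case: (s j) => /=; field.
congr conj_diag; apply/rowP=> i; rewrite !mxE.
have [->|neq_s] := eqVneq (anc i) s; first by apply: big1 => j _; rewrite eqxx.
have [j neq_j|eqs] := pickP (fun j => anc i j != s j).
  by rewrite (bigD1 j) //= (negbTE neq_j) mul0r.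
by case/eqP: neq_s; apply/ffunP=> j; apply/eqP/negbFE/eqs.
Qed.

Lemma synproj_adj s : (synproj n k U s)^H = synproj n k U s.
Proof. by rewrite synprojE conj_diag_adj // => i; rewrite mxE rmorph_nat. Qed.

(** A syndrome for arbitrary matrices, recorded by signs instead of a commutation test. *)
Definition commutes_up_to W s := forall j, W *m g j = (-1) ^+ s j *: (g j *m W).

(** Conjugation by [U] makes [g j] a diagonal of signs. Comparing the entries at [i], [i'] on both
    sides and cancelling the nonzero entry leaves an equality of signs, hence of bits. *)
Lemma commutes_up_to_shift W s i i' : commutes_up_to W s ->
  (U^H *m W *m U) i i' != 0 -> forall j, anc i j = anc i' j (+) s j.
Proof.
move=> Ws nz j.
have := congr1 (fun A => U^H *m A *m U) (Ws j); rewrite genE /conj_diag.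
rewrite -scalemxAr -scalemxAl !mulmxA mulUHU mul1mx.
rewrite -[_ *m U^H *m U]mulmxA mulUHU mulmx1.
rewrite -[X in _ = _ *: X]mulmxA -[X in _ = _ *: X]mulmxA [U^H *m (_ *m _)]mulmxA.
rewrite mul_mx_diag mul_diag_mx; move: (U^H *m W *m U) nz => V nz.
move=> /matrixP/(_ i i'); rewrite !mxE.
rewrite mulrA [LHS]mulrC => /(mulIf nz); rewrite -signr_addb => /signr_inj ->.
by rewrite addbAC addbb.
Qed.

(* [U^H W U] shifts ancilla bits by [t] and [U^H V U] by [s]: starting from ancilla [0],
   the projector only lets [s = t] through, and [V] then shifts back to [0]. *)
Lemma kraus_op_entry V W t s i i' :
  commutes_up_to V s -> commutes_up_to W t -> anc i' = zero_syndrome n k ->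
  (U^H *m V *m synproj n k U s *m W *m U) i i'
  = if (s == t) && (anc i == zero_syndrome n k) then (U^H *m V *m W *m U) i i' else 0.
Proof.
move=> Vs Wt i'0.
have -> : U^H *m V *m synproj n k U s *m W *m U
   = (U^H *m V *m U *m diag_mx (\row_x (anc x == s)%:R)) *m (U^H *m W *m U).
  by rewrite synprojE /conj_diag !mulmxA.
have -> : U^H *m V *m W *m U = (U^H *m V *m U) *m (U^H *m W *m U).
  by rewrite !mulmxA -[_ *m U *m U^H]mulmxA mulUUH mulmx1.
rewrite mul_mx_diag; move EV : (U^H *m V *m U) => V'; move EW : (U^H *m W *m U) => W'.
rewrite -[RHS]mulr1 mxE.
transitivity (((s == t) && (anc i == zero_syndrome n k))%:R * (V' *m W') i i'); last first.
  by case: ifP; rewrite ?mul0r ?mul1r // mulr1.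
(* Compare the contributions of each intermediate state [x]. If both entries are nonzero, the shifts
   determine the ancilla bits of [x] and then of [i]. *)
rewrite mxE mulr_sumr; apply: eq_bigr => x _; rewrite !mxE.
have [->|nzW] := eqVneq (W' x i') 0; first by rewrite !mulr0.
have [->|nzV] := eqVneq (V' i x) 0; first by rewrite !(mulr0, mul0r).
rewrite -EW in nzW; rewrite -EV in nzV.
have xE : anc x = t.
  apply/ffunP => j; rewrite (commutes_up_to_shift _ _ _ _ Wt nzW) i'0.
  by rewrite ffunE.
have iE j := commutes_up_to_shift _ _ _ _ Vs nzV j.
rewrite xE [t == s]eq_sym; case: eqP => [st|_] /=; last by rewrite mulr0 !mul0r.
rewrite (_ : anc i == _ = true) ?mulr1 ?mul1r //.
by apply/zero_syndromeP => j; rewrite iE xE st addbb.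
Qed.

(** * Pauli syndromes and the stabilizer group *)

Hypothesis cliffU : forall P, exists (Q : pstring n) (c : C),
  U *m pmat n P *m U^H = c *: pmat n Q.

(** The Clifford property makes [g j] a multiple of a Pauli string, so a Pauli that does not commute
    with it anticommutes. *)
Lemma pmat_syndrome P : commutes_up_to (pmat n P) (syndrome n k U P).
Proof.
move=> j; rewrite /syndrome ffunE.
case: eqP => [->|ncomm] /=; first by rewrite scale1r.
have [Q [c gE]] := cliffU (zstring n (ancq n k j)).
have [[] PQ] := pmat_comm R n P Q.
  by rewrite /gen gE -scalemxAl -scalemxAr PQ !scalerA mulrC.
by case: ncomm; rewrite /gen gE -scalemxAl -scalemxAr PQ scale1r.
Qed.

Lemma syndrome_unique P s :
  commutes_up_to (pmat n P) s -> s = syndrome n k U P.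
Proof.
move=> Ps; apply/ffunP=> j; apply/(@signr_inj C).
(* Both factors are involutions, so their product is nonzero and determines the sign. *)
have nz : g j *m pmat n P != 0.
  apply/eqP => z; have /matrixP/(_ (Ordinal (pow2_gt0 n)) (Ordinal (pow2_gt0 n)))
    : (1%:M : 'M[C]_(2 ^ n)) = 0.
    by rewrite -(gen_sqr j) -{1}[g j]mulmx1 -(pmat_sqr R n P) mulmxA z !mul0mx.
  by rewrite !mxE eqxx => /eqP; rewrite oner_eq0.
have := pmat_syndrome P j; rewrite Ps => /eqP.
by rewrite -subr_eq0 -scalerBl scaler_eq0 (negbTE nz) orbF subr_eq0 => /eqP.
Qed.

(** All three properties pass from generators to products, and elements with sign diagonals are
    their own inverses. The signs yield involutivity and self-adjointness; the value 1 at ancilla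
    zero says that the code space is fixed. *)
Lemma inStab_diag A : inStab n k U A -> exists d : 'rV[C]_(2 ^ n),
  [/\ A = conj_diag d, forall i, exists b : bool, d 0 i = (-1) ^+ b
    & forall i, anc i = zero_syndrome n k -> d 0 i = 1].
Proof.
elim=> {A} [j||A B _ [d [-> d_sgn d1]] _ [e [-> e_sgn e1]]|A _ [d [-> d_sgn d1]]].
- exists (\row_i (-1) ^+ anc i j); split=> [|i|i i0]; first exact: genE.
    by exists (anc i j); rewrite mxE.
  by rewrite mxE i0 ffunE.
- exists (const_mx 1); split=> [|i|i _]; rewrite ?conj_diag1 ?mxE //.
  by exists false.
- exists (\row_i (d 0 i * e 0 i)); split=> [|i|i i0]; first by rewrite conj_diagM.
    rewrite mxE; have [b ->] := d_sgn i; have [b' ->] := e_sgn i.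
    by exists (b (+) b'); rewrite signr_addb.
  by rewrite mxE d1 // e1 // mulr1.
exists d; split=> //.
apply: invmx_involution.
rewrite conj_diagM -conj_diag1; congr conj_diag; apply/rowP=> i; rewrite !mxE.
by have [b ->] := d_sgn i; rewrite -expr2 sqrr_sign.
Qed.

Lemma inStab_sqr A : inStab n k U A -> A *m A = 1%:M.
Proof.
case/inStab_diag=> d [-> d_sgn _]; rewrite conj_diagM -conj_diag1.
congr conj_diag; apply/rowP=> i; rewrite !mxE.
by have [b ->] := d_sgn i; rewrite -expr2 sqrr_sign.
Qed.

Lemma inStab_pauli A : inStab n k U A -> exists (c : C) P, A = c *: pmat n P.
Proof.
elim=> {A} [j||A B _ [c [P ->]] _ [d [Q ->]]|A SA [c [P AE]]].
- by have [Q [c gE]] := cliffU (zstring n (ancq n k j)); exists c, Q.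
- by exists 1, (idstring n); rewrite scale1r pmat_idstring.
- have [e [S PQ]] := pmat_mul R n P Q.
  by exists (c * (d * e)), S; rewrite -scalemxAl -scalemxAr PQ !scalerA mulrA.
by exists c, P; rewrite (invmx_involution _ _ _ (inStab_sqr _ SA)).
Qed.

(** * Traces against the code projector *)

Let P0 := synproj n k U (zero_syndrome n k).

Lemma inStab_fix A : inStab n k U A -> A *m P0 = P0.
Proof.
case/inStab_diag=> d [-> _ d1]; rewrite /P0 synprojE conj_diagM.
congr conj_diag; apply/rowP=> i; rewrite !mxE.
by case: eqP => [/d1 ->|_]; rewrite ?mulr1 ?mulr0.
Qed.

Lemma inStab_gen_comm A j : inStab n k U A -> A *m g j = g j *m A.
Proof. by case/inStab_diag=> d [-> _ _]; rewrite genE conj_diag_comm. Qed.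

Lemma inStab_adj A : inStab n k U A -> A^H = A.
Proof.
case/inStab_diag=> d [-> d_sgn _]; apply: conj_diag_adj => i.
by have [b ->] := d_sgn i; rewrite rmorph_sign.
Qed.

(** Instead of writing [P0] as an average over the group, the factors $(1+g_j)/2$ are expanded one
    at a time. *)
Lemma code_trace0 W :
  (forall A, inStab n k U A -> \tr (W *m A) = 0) -> \tr (W *m P0) = 0.
Proof.
move=> tr0; rewrite /P0 /synproj.
(* The prefix [A] collects the generators already picked, so that the induction on the remaining
   factors goes through. *)
suff tr0_mul l A : inStab n k U A -> \tr (W *m (A *m
    \big[mulmx/1%:M]_(j <- l)
      (2^-1 *: (1%:M + (if zero_syndrome n k j then -1 else 1) *: g j)))) = 0.
  by rewrite -[X in W *m X]mul1mx; apply/tr0_mul/Stab_one.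
elim: l A => [|j l IH] A SA; first by rewrite big_nil mulmx1 tr0.
rewrite big_cons ffunE scale1r -scalemxAl mulmxDl mul1mx -scalemxAr mulmxDr [A *m (_ *m _)]mulmxA.
rewrite -scalemxAr mulmxDr mxtraceZ mxtraceD IH // IH ?addr0 ?mulr0 //.
by apply: Stab_mul SA _; apply: Stab_gen.
Qed.

(** Stabilizer elements commute with every generator and leave the syndrome unchanged. Hence the
    representative in any decomposition of [P] is the one the decoder applies. *)
Lemma inTS_syndrome (T : syndrome_t n k -> pstring n) P s A c :
  (forall s, syndrome n k U (T s) = s) -> inStab n k U A ->
  pmat n P = c *: (pmat n (T s) *m A) -> syndrome n k U P = s.
Proof.
move=> T_syn SA PE; apply/esym/syndrome_unique => j.
rewrite PE -scalemxAl -mulmxA inStab_gen_comm // mulmxA pmat_syndrome T_syn.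
by rewrite -!scalemxAl -scalemxAr !scalerA mulmxA mulrC.
Qed.

Hypothesis le_kn : (k <= n)%N.

Lemma trace_P0 : \tr P0 = 2 ^+ k.
Proof.
rewrite /P0 synprojE /conj_diag mxtrace_mulC mulmxA mulUHU mul1mx mxtrace_diag.
rewrite (eq_bigr (fun i => if anc i == zero_syndrome n k then 1 else 0)) => [|i _].
  by rewrite -big_mkcond (sum_anc0 _ _ le_kn _ (fun=> 1)) sumr_const card_ord natrX.
by rewrite mxE; case: ifP.
Qed.

Variable T : syndrome_t n k -> pstring n.
Hypothesis T_syn : forall s, syndrome n k U (T s) = s.

Lemma sqr_norm_code_trace P :
  `|\tr (pmat n (T (syndrome n k U P)) *m pmat n P *m P0)| ^+ 2
  = if `[< inTS n k U T P >] then (2 ^+ k) ^+ 2 else 0.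
Proof.
case: asboolP => [[s [A [c [SA PE]]]]|notTS].
  rewrite (inTS_syndrome _ _ _ _ _ T_syn SA PE).
  (* Since [P], [T s] and [A] are self-adjoint involutions, $P^\dagger P = 1$ forces $|c| = 1$. *)
  have c1 : `|c| ^+ 2 = 1.
    have := pmat_sqr R n P; rewrite -{1}(pmat_adj _ _ P) PE adj_scale adj_mul.
    rewrite pmat_adj inStab_adj // -scalemxAl -scalemxAr scalerA !mulmxA.
    rewrite -[A *m _ *m _]mulmxA pmat_sqr mulmx1 inStab_sqr // => /matrixP.
    move/(_ (Ordinal (pow2_gt0 n)) (Ordinal (pow2_gt0 n))); rewrite !mxE eqxx mulr1.
    by rewrite normCK mulrC.
  rewrite PE -scalemxAr mulmxA pmat_sqr mul1mx -scalemxAl inStab_fix //.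
  by rewrite mxtraceZ trace_P0 normrM exprMn c1 mul1r ger0_norm ?exprn_ge0.
rewrite code_trace0 ?normr0 ?expr0n // => A SA.
(* Both [A] and the product of the representative with [P] are multiples of Pauli strings, so a
   nonzero trace requires the two strings to coincide. *)
have [d [Q AE]] := inStab_pauli A SA.
have [e [W TPE]] := pmat_mul R n (T (syndrome n k U P)) P.
rewrite TPE AE -scalemxAl -scalemxAr scalerA mxtraceZ.
have [WQ|/pmat_tr0 ->] := eqVneq W Q; last by rewrite mulr0.
have [->|d0] := eqVneq d 0; first by rewrite mulr0 mul0r.
(* With $T_sP = eW$ and $A = dW$, the involution $T_s$ gives $P = eT_sW = (e/d)T_sA$. *)
case: notTS; exists (syndrome n k U P), A, (e / d); split=> //.
rewrite AE -WQ -scalemxAr scalerA divfK // scalemxAr -TPE mulmxA pmat_sqr mul1mx //.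
Qed.

End Code.

(** * The encoded channel *)

Section Channel.
Variables (R : rcfType) (n k : nat) (U : 'M[R[i]]_(2 ^ n)).
Variables (T : syndrome_t n k -> pstring n) (p : R).
Hypotheses (le_kn : (k <= n)%N) (cliffordU : clifford n U).
Hypothesis T_syn : forall s, syndrome n k U (T s) = s.
Local Notation C := R[i].
Local Notation "A ^H" := (adj _ _ A) (at level 1, format "A ^H").
Local Notation jidx := (joint_idx n k).

(** Kept on all $n$ qubits: the Kraus operators of the encoded channel, up to the weights [perr],
    are its blocks from ancilla 0 to ancilla [c], addressed by [jidx]. *)
Definition kraus_op s P : 'M[C]_(2 ^ n) :=
  U^H *m pmat n (T s) *m synproj n k U s *m pmat n P *m U.

Lemma decode_depol_encode_delta (a b : 'I_(2 ^ k)) :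
  decode n k U T (depol n p (encode n k U (delta_mx a b))) a b
  = \sum_P (perr n p P)%:C * \sum_s \sum_(c < 2 ^ (n - k))
      kraus_op s P (jidx a c) (jidx a 0) * Num.conj (kraus_op s P (jidx b c) (jidx b 0)).
Proof.
rewrite /decode mxE.
under eq_bigr => c _.
  rewrite summxE.
  under eq_bigr => s _.
    rewrite depol_kraus mulmx_sumr !mulmx_suml summxE.
    under eq_bigr => P _.
      rewrite -scalemxAr -!scalemxAl mxE.
      (* Projectors and Paulis being self-adjoint, the right-hand factors assemble into the adjoint
         of the Kraus operator. *)
      have -> : U^H *m pmat n (T s) *m synproj n k U s *m
          (pmat n P *m encode n k U (delta_mx a b) *m pmat n P) *m synproj n k U s
          *m (pmat n (T s))^H *m U
        = kraus_op s P *m delta_mx (jidx a 0) (jidx b 0) *m (kraus_op s P)^H.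
        rewrite /encode attach_anc_delta // /kraus_op !adj_mul synproj_adj ?adjK;
          last exact: (proj1 cliffordU).
        by rewrite !pmat_adj !mulmxA.
      rewrite mulmx_deltaE adjE.
    over.
  over.
over.
rewrite exchange_big /=; under eq_bigr do rewrite exchange_big /=.
rewrite exchange_big /=; apply: eq_bigr => P _; rewrite mulr_sumr.
by apply: eq_bigr => s _; rewrite mulr_sumr.
Qed.

Lemma kraus_opE s P (a : 'I_(2 ^ k)) (c : 'I_(2 ^ (n - k))) :
  kraus_op s P (jidx a c) (jidx a 0)
  = if (s == syndrome n k U P) && (c == 0 :> nat)
    then (U^H *m pmat n (T s) *m pmat n P *m U) (jidx a 0) (jidx a 0) else 0.
Proof.
have [unitU cliffU] := cliffordU.
have anc0 : anc_bits n k (jidx a 0) = zero_syndrome n k.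
  by apply/eqP; rewrite (anc_bits_joint n k le_kn a (Ordinal (pow2_gt0 (n - k)))).
have Ts : commutes_up_to R n k U (pmat n (T s)) s.
  by rewrite -{2}(T_syn s); apply: pmat_syndrome.
rewrite /kraus_op (kraus_op_entry R n k U unitU (pmat n (T s)) (pmat n P)
  (syndrome n k U P) s (jidx a c) (jidx a 0) Ts (pmat_syndrome R n k U cliffU P) anc0).
rewrite (anc_bits_joint n k le_kn a c).
by case: ifP => // /andP[_ /eqP ->].
Qed.

(** Diagonal entries at ancilla zero are selected by the diagonal form of [P0]; cyclicity of the
    trace moves [U] across. *)
Lemma tr_kraus_op P : let s := syndrome n k U P in
  \sum_(a < 2 ^ k) (U^H *m pmat n (T s) *m pmat n P *m U) (jidx a 0) (jidx a 0)
  = \tr (pmat n (T s) *m pmat n P *m synproj n k U (zero_syndrome n k)).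
Proof.
have [unitU _] := cliffordU; move=> s.
rewrite -(sum_anc0 n k le_kn _ (fun i => (U^H *m pmat n (T s) *m pmat n P *m U) i i)).
rewrite synprojE // /conj_diag !mulmxA mxtrace_mulC !mulmxA.
rewrite big_mkcond mul_mx_diag /mxtrace; move: (U^H *m _ *m _ *m U) => V.
by apply: eq_bigr => i _; rewrite !mxE; case: ifP; rewrite ?mulr1 ?mulr0.
Qed.

(** Once only the true syndrome and [c = 0] remain, the double sum over [a] and [b] is the code
    trace times its conjugate. *)
Lemma sum_kraus_op P :
  \sum_(a < 2 ^ k) \sum_(b < 2 ^ k) \sum_s \sum_(c < 2 ^ (n - k))
      kraus_op s P (jidx a c) (jidx a 0) * Num.conj (kraus_op s P (jidx b c) (jidx b 0))
  = if `[< inTS n k U T P >] then (2 ^+ k) ^+ 2 else 0.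
Proof.
have [unitU cliffU] := cliffordU.
rewrite -(sqr_norm_code_trace R n k U unitU cliffU le_kn T T_syn) -tr_kraus_op normCK.
rewrite rmorph_sum mulr_suml; apply: eq_bigr => a _.
rewrite mulr_sumr; apply: eq_bigr => b _.
rewrite (bigD1 (syndrome n k U P)) //= [X in _ + X]big1 ?addr0 => [|s /negbTE sP]; last first.
  by apply: big1 => c _; rewrite kraus_opE sP mul0r.
rewrite (bigD1 (Ordinal (pow2_gt0 (n - k)))) //= [X in _ + X]big1 ?addr0 => [|c /negbTE c0];
  last first.
  by rewrite kraus_opE -[0%N]/(val (Ordinal (pow2_gt0 (n - k)))) [nat_of_ord c == _]c0 andbF mul0r.
have E x := kraus_opE (syndrome n k U P) P x (Ordinal (pow2_gt0 (n - k))).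
by rewrite eqxx /= in E; rewrite !E.
Qed.

Lemma channel_fidelityE :
  chan_fid (2 ^ k) (fun rho : 'M[C]_(2 ^ k) =>
     decode n k U T (depol n p (encode n k U rho)))
  = (\sum_(P : pstring n | `[< inTS n k U T P >]) perr n p P)%:C.
Proof.
rewrite chan_fidE; under eq_bigr => a _.
  under eq_bigr => b _ do rewrite decode_depol_encode_delta.
  rewrite exchange_big; over.
rewrite exchange_big /= rmorph_sum mulr_sumr [RHS]big_mkcond /=.
apply: eq_bigr => P _.
under eq_bigr do rewrite -mulr_sumr.
rewrite -mulr_sumr sum_kraus_op natrX.
case: ifP => _; last by rewrite !mulr0.
have nz : (2 ^+ k : C) != 0 by rewrite expf_neq0 ?pnatr_eq0.
(* The normalization $(2^k)^{-2}$ of the fidelity cancels the squared trace of [P0]. *)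
by rewrite mulrCA -exprMn mulVf // expr1n mulr1.
Qed.

End Channel.

(** * The weight enumerator *)

Lemma perr_weight (R : rcfType) n (p : R) (P : pstring n) :
  perr n p P = qw n p (weight n P).
Proof.
rewrite /perr /qw /weight (bigID (fun q => P q == 0)) /=.
rewrite (eq_bigr (fun=> 1 - 3 / 4 * p)) => [|q ->] //.
rewrite [X in _ * X](eq_bigr (fun=> p / 4)) => [|q /negbTE ->] //.
rewrite !prodr_const cardsE; congr (_ ^+ _ * _).
(* The identity positions number [n] minus the weight. *)
by rewrite -[X in (X - _)%N]card_ord -(cardC [pred q | P q == 0]) addnK.
Qed.

Theorem theorem4 (R : rcfType) (n k : nat) (U : 'M[R[i]]_(2 ^ n))
  (T : syndrome_t n k -> pstring n) (p : R) :
  (k <= n)%N ->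
  clifford n U ->
  (forall s : syndrome_t n k, syndrome n k U (T s) = s) ->
  T (zero_syndrome n k) = idstring n ->
  0 <= p <= 1 ->
  chan_fid (2 ^ k) (fun rho : 'M[R[i]]_(2 ^ k) =>
              decode n k U T (depol n p (encode n k U rho)))
  = (\sum_(P : pstring n | `[< inTS n k U T P >]) perr n p P)%:C
  /\ \sum_(P : pstring n | `[< inTS n k U T P >]) perr n p P
     = \sum_(w < n.+1) (aw n k U T w)%:R * qw n p w.
Proof.
move=> le_kn cliffU T_syn _ _; split; first exact: channel_fidelityE.
have weight_lt P : (weight n P < n.+1)%N.
  by rewrite ltnS (leq_trans (max_card _)) ?card_ord.
(* Group the Pauli strings by weight; within a class all have probability [qw n p w]. *)
rewrite (partition_big (fun P => Ordinal (weight_lt P)) predT) //=.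
apply: eq_bigr => w _; rewrite /aw mulr_natl -sumr_const.
apply: eq_big => [P|P]; first by rewrite inE -val_eqE.
by case/andP=> _ /eqP <-; apply: perr_weight.
Qed.
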